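(* Let $\mu$ be a joint distribution of $(X,A,Y)$ with $X\in\mathcal X$, $A\in\mathcal A$ ($\mathcal A$ finite), $Y\in\mathbb R$, $\mathbb E[Y^2]<\infty$. Let $w_a=\Pr(A=a)$, let $f^*(x,a)=\mathbb E[Y\mid X=x,A=a]$ be the Bayes regressor, and let $r^*_a$ be the distribution of $f^*(X,A)$ conditioned on $A=a$. Then for every $\alpha\ge 0$, \[ \inf_{f:\ \Delta_{\mathrm{SP}}(f)\le\alpha}\ \mathit{ER}(f)\;=\;\inf_{\substack{q:\ \mathrm{supp}(q)\subseteq\mathbb R\\ \{q_a\}_{a\in\mathcal A}\subset B_{\mathrm{KS}}(q,\alpha/2)}}\ \sum_{a\in\mathcal A} w_a\, W_2^2(r^*_a,q_a), \] where the infimum on the left ranges over all (possibly randomized) attribute-aware regressors $f:\mathcal X\times\mathcal A\to\mathbb R$ (the paper states both sides as minima).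
   Context: A randomized regressor $f:\mathcal X\times\mathcal A\to\mathbb R$ is given by a Markov kernel $\mathcal K((x,a),\cdot)$: $\Pr(f(x,a)\in T)=\mathcal K((x,a),T)$, with the randomness of $f$ independent of $(X,A,Y)$. Excess risk: $\mathit{ER}(f)=\mathbb E[(f(X,A)-Y)^2]-\mathbb E[(f^*(X,A)-Y)^2]=\mathbb E[(f(X,A)-f^*(X,A))^2]$. Kolmogorov–Smirnov distance between probability measures $p,q$ on $\mathbb R$: $D_{\mathrm{KS}}(p,q)=\sup_{t\in\mathbb R}|p((-\infty,t])-q((-\infty,t])|$. Statistical parity gap: $\Delta_{\mathrm{SP}}(f)=\max_{a,a'\in\mathcal A}D_{\mathrm{KS}}(r_a,r_{a'})$, where $r_a$ is the distribution of $f(X,A)$ conditioned on $A=a$. $B_{\mathrm{KS}}(q,\rho)=\{p \text{ probability measure on }\mathbb R: D_{\mathrm{KS}}(p,q)\le\rho\}$. $W_2^2(p,q)=\inf_{\pi\in\Pi(p,q)}\int(y-y')^2\,d\pi(y,y')$, where $\Pi(p,q)$ is the set of couplings of $p$ and $q$. *)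

(* Defs.v *)
From HB Require Import structures.
From mathcomp Require Import all_boot all_order all_algebra.
From mathcomp Require Import all_classical all_reals all_analysis.
From mathcomp Require Import measurable_realfun.
Set Implicit Arguments. Unset Strict Implicit. Unset Printing Implicit Defensive.
Import Order.TTheory GRing.Theory Num.Theory.
Import numFieldNormedType.Exports.
Local Open Scope classical_set_scope.
Local Open Scope ring_scope.
Local Open Scope ereal_scope.

Section FairDefs.
Context {R : realType}.

Definition D_KS (p q : set R -> \bar R) : \bar R :=
  ereal_sup [set `| p `]-oo, t]%classic - q `]-oo, t]%classic | | t in [set: R]].

Definition couplings (p q : set R -> \bar R) : set (probability (R * R)%type R) :=
  [set pi | (forall B : set R, measurable B -> pi (B `*` setT) = p B) /\
            (forall B : set R, measurable B -> pi (setT `*` B) = q B)].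

Definition W2sq (p q : set R -> \bar R) : \bar R :=
  ereal_inf [set \int[pi]_z ((z.1 - z.2) ^+ 2)%:E | pi in couplings p q].

Definition DeltaSP (A : finType) (r : A -> set R -> \bar R) : \bar R :=
  ereal_sup [set D_KS (r a) (r a') | a in [set: A] & a' in [set: A]].

Context {dO : measure_display} {Omega : measurableType dO} (P : probability Omega R)
        {dX : measure_display} {Xsp : measurableType dX} {A : finType}
        (X : Omega -> Xsp) (Aa : Omega -> A).

Definition wA (a : A) : R := fine (P (Aa @^-1` [set a])).

(* distribution of f(X,A) given A = a, for a randomized regressor given by
   the Markov kernel K : (x,a) |-> K a x *)
Definition r_of (K : A -> Xsp -> probability R R) (a : A) : set R -> \bar R :=
  fun T => ((wA a)^-1)%:E * \int[P]_(w in Aa @^-1` [set a]) K a (X w) T.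

Definition r_det (g : Xsp -> A -> R) (a : A) : set R -> \bar R :=
  fun T => ((wA a)^-1)%:E * P (Aa @^-1` [set a] `&` (fun w => g (X w) a) @^-1` T).

Definition markov_kernel (K : A -> Xsp -> probability R R) : Prop :=
  forall a (T : set R), measurable T -> measurable_fun [set: Xsp] (fun x => K a x T).

Definition ER (fstar : Xsp -> A -> R) (K : A -> Xsp -> probability R R) : \bar R :=
  \int[P]_w (\int[K (Aa w) (X w)]_y ((y - fstar (X w) (Aa w)) ^+ 2)%:E).

End FairDefs.

(* Main.v *)
(* A randomized regressor f induces, in each group a, a coupling of r*_a with the law
   of f given A = a whose cost is the excess risk of f in that group; conversely a
   coupling is turned into a randomized regressor by conditioning on f*(X,A).
   Since only infima are compared, no exact disintegration is needed: it is enough to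
   condition on the cell of f*(X,A) in a partition of R into intervals of length delta,
   which preserves the second marginal exactly and raises the cost by O(delta).
   The parity constraints match because finitely many laws at pairwise KS-distance at
   most alpha have a common center at KS-distance at most alpha/2, namely the law
   whose cdf is halfway between their pointwise extreme cdfs. *)
Require Import Defs.
From HB Require Import structures.
From mathcomp Require Import all_boot all_order all_algebra.
From mathcomp Require Import all_classical all_reals all_analysis.
From mathcomp Require Import measurable_realfun.
From mathcomp Require Import ring lra.
Import Order.TTheory GRing.Theory Num.Theory.
Import numFieldNormedType.Exports.
Local Open Scope classical_set_scope.
Local Open Scope ring_scope.
Local Open Scope ereal_scope.
Set Implicit Arguments.
Unset Strict Implicit.

(** * Cumulative distribution functions and their lattice operations *)

Section cdfs.
Context {R : realType}.
Local Open Scope ring_scope.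

Definition is_cdf (f : R -> R) : Prop :=
  [/\ {homo f : x y / x <= y}, right_continuous f,
      f @ -oo --> (0 : R) & f @ +oo --> (1 : R)].

Lemma cvg_maxr (T : Type) (F : set_system T) (FF : Filter F) (f g : T -> R) (a b : R) :
  f @ F --> a -> g @ F --> b -> (fun x => Num.max (f x) (g x)) @ F --> Num.max a b.
Proof.
move=> fa gb; rewrite maxr_absE.
under eq_fun do rewrite maxr_absE.
apply: cvgM; last exact: cvg_cst.
by apply: cvgD; [exact: cvgD|apply: cvg_norm; exact: cvgB].
Qed.

Lemma cvg_minr (T : Type) (F : set_system T) (FF : Filter F) (f g : T -> R) (a b : R) :
  f @ F --> a -> g @ F --> b -> (fun x => Num.min (f x) (g x)) @ F --> Num.min a b.
Proof.
move=> fa gb; rewrite minr_absE.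
under eq_fun do rewrite minr_absE.
apply: cvgM; last exact: cvg_cst.
by apply: cvgB; [exact: cvgD|apply: cvg_norm; exact: cvgB].
Qed.

Lemma is_cdf_max (f g : R -> R) :
  is_cdf f -> is_cdf g -> is_cdf (fun x => Num.max (f x) (g x)).
Proof.
move=> [f1 f2 f3 f4] [g1 g2 g3 g4]; split.
- by move=> x y xy; rewrite ge_max !le_max f1// g1// orbT.
- by move=> x; apply: cvg_maxr; [exact: f2|exact: g2].
- by rewrite -(maxxx (0 : R)); exact: cvg_maxr.
- by rewrite -(maxxx (1 : R)); exact: cvg_maxr.
Qed.

Lemma is_cdf_min (f g : R -> R) :
  is_cdf f -> is_cdf g -> is_cdf (fun x => Num.min (f x) (g x)).
Proof.
move=> [f1 f2 f3 f4] [g1 g2 g3 g4]; split.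
- by move=> x y xy; rewrite le_min !ge_min f1// g1// orbT.
- by move=> x; apply: cvg_minr; [exact: f2|exact: g2].
- by rewrite -(minxx (0 : R)); exact: cvg_minr.
- by rewrite -(minxx (1 : R)); exact: cvg_minr.
Qed.

Lemma cvg_midpoint (T : Type) (F : set_system T) (FF : Filter F) (f g : T -> R) (a b : R) :
  f @ F --> a -> g @ F --> b -> (fun x => (f x + g x) / 2) @ F --> (a + b) / 2.
Proof. by move=> fa gb; apply: cvgM; [exact: cvgD|exact: cvg_cst]. Qed.

Lemma is_cdf_midpoint (f g : R -> R) :
  is_cdf f -> is_cdf g -> is_cdf (fun x => (f x + g x) / 2).
Proof.
move=> [f1 f2 f3 f4] [g1 g2 g3 g4]; split.
- by move=> x y xy; have := f1 _ _ xy; have := g1 _ _ xy; lra.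
- by move=> x; apply: cvg_midpoint; [exact: f2|exact: g2].
- have E : (0 + 0) / 2 = 0 :> R by lra.
  by rewrite -[X in _ --> X]E; exact: cvg_midpoint.
- have E : (1 + 1) / 2 = 1 :> R by lra.
  by rewrite -[X in _ --> X]E; exact: cvg_midpoint.
Qed.

(** [max] and [min] on [R] have no neutral element, so the fold starts from a cdf [f0]. Taking [f0]
    in the family leaves the extremes unchanged. *)
Lemma is_cdf_big (I : finType) (op : R -> R -> R) (f0 : R -> R) (f : I -> R -> R) :
  (forall g h, is_cdf g -> is_cdf h -> is_cdf (fun x => op (g x) (h x))) ->
  is_cdf f0 -> (forall i, is_cdf (f i)) ->
  is_cdf (fun x => \big[op/f0 x]_i f i x).
Proof.
move=> opP f0P fP; elim: (index_enum I) => [|i s ih].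
  by under eq_fun do rewrite big_nil.
by under eq_fun do rewrite big_cons; exact: opP.
Qed.

(** The identity is a random variable of law [p], so the known properties of [cdf] apply. *)
Lemma is_cdf_probability (p : probability R R) :
  is_cdf (fun t => fine (p `]-oo, t]%classic)).
Proof.
pose H := @isMeasurableFun.Build _ _ R R (@idfun R) (@measurable_id _ _ setT).
pose X : {RV p >-> R} := HB.pack (@idfun R) H.
have pX t : p `]-oo, t]%classic = cdf X t.
  by rewrite /cdf /distribution /pushforward preimage_id.
under eq_fun do rewrite pX.
split.
- by move=> x y xy; rewrite fine_le ?fin_num_measure// cdf_nondecreasing.
- move=> x; apply: fine_cvg.
  by rewrite fineK ?fin_num_measure//; exact: cdf_right_continuous.
- by apply: fine_cvg; exact: cvg_cdfNy0.
- by apply: fine_cvg; exact: cvg_cdfy1.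
Qed.

Lemma probability_of_cdf (f : R -> R) : is_cdf f ->
  exists q : probability R R, forall t, q `]-oo, t]%classic = (f t)%:E.
Proof.
move=> [f1 f2 f3 f4].
pose h := f.
pose H1 := isCumulative.Build R _ R h f1 f2.
pose H2 := isCumulativeBounded.Build R 0 1 h f3 f4.
pose F : cumulativeBounded (0 : R) (1 : R) := HB.pack h H1 H2.
(* The Stieltjes measure lives on [measurableTypeR R]; its image under the identity is a probability
   on [R]. *)
pose Q : probability (measurableTypeR R) R := lebesgue_stieltjes_measure F.
pose H := @isMeasurableFun.Build _ _ (measurableTypeR R) R (@idfun R)
  (@measurable_id _ _ setT).
pose X : {RV Q >-> R} := HB.pack (@idfun R : measurableTypeR R -> R) H.
by exists (distribution Q X) => t; exact: cdf_lebesgue_stieltjes_id.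
Qed.

End cdfs.

(** * Kolmogorov-Smirnov distance and common centers *)

Section kolmogorov.
Context {R : realType}.
Implicit Types p q : set R -> \bar R.

Lemma D_KS_leP p q (c : \bar R) : reflect
  (forall t : R, `|p `]-oo, t]%classic - q `]-oo, t]%classic| <= c)
  (D_KS p q <= c).
Proof.
apply: (iffP idP) => [h t|h].
  by apply: le_trans h; apply: ereal_sup_ubound; exists t.
by apply: ge_ereal_sup => _ [t _ <-]; exact: h.
Qed.

Lemma D_KS_le_fineP (p q : probability R R) (c : R) : reflect
  (forall t : R,
    (`|fine (p `]-oo, t]%classic) - fine (q `]-oo, t]%classic)| <= c)%R)
  (D_KS p q <= c%:E).
Proof.
have E t : `|p `]-oo, t]%classic - q `]-oo, t]%classic| =
    (`|fine (p `]-oo, t]%classic) - fine (q `]-oo, t]%classic)|%R)%:E.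
  by rewrite -abse_EFin EFinB !fineK ?fin_num_measure.
by apply: (iffP (@D_KS_leP _ _ _)) => h t; have := h t; rewrite E lee_fin.
Qed.

Lemma DeltaSP_leP (A : finType) (r : A -> set R -> \bar R) (c : \bar R) :
  reflect (forall a a', D_KS (r a) (r a') <= c) (DeltaSP r <= c).
Proof.
apply: (iffP idP) => [h a a'|h].
  by apply: le_trans h; apply: ereal_sup_ubound; exists a => //; exists a'.
by apply: ge_ereal_sup => _ [a _] [a' _ <-]; exact: h.
Qed.

(** At each [t] the cdf values fill an interval of length at most [c], so its midpoint is within
    [c / 2] of all of them. Finiteness of [A] makes the pointwise extremes cdfs again; [a0] seeds
    the two folds. *)
Lemma D_KS_center (A : finType) (a0 : A) (p : A -> probability R R) (c : R) :
  (forall a a', D_KS (p a) (p a') <= c%:E) ->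
  exists q : probability R R, forall a, D_KS (p a) q <= (c / 2)%:E.
Proof.
move=> pc; pose F a t := fine (p a `]-oo, t]%classic).
have Fc a a' t : (F a t <= F a' t + c)%R.
  by have /D_KS_le_fineP/(_ t) := pc a a'; rewrite -/(F a t) -/(F a' t) ler_norml; lra.
pose U t := \big[Num.max/F a0 t]_a F a t; pose L t := \big[Num.min/F a0 t]_a F a t.
have [q qE] : exists q : probability R R,
    forall t, q `]-oo, t]%classic = ((U t + L t) / 2)%:E.
  apply/probability_of_cdf/is_cdf_midpoint; apply: is_cdf_big => *;
    by [exact: is_cdf_max|exact: is_cdf_min|exact: is_cdf_probability].
exists q => a; apply/D_KS_le_fineP => t; rewrite qE/= -/(F a t).
have ? : (F a t <= U t)%R by exact: le_bigmax.
have ? : (L t <= F a t)%R by exact: bigmin_le.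
(* Every value is at most [c] above every other one, the seeds included. *)
have ? : (U t - c <= L t)%R.
  apply: le_bigmin => [|a' _]; rewrite lerBlDr; apply: bigmax_le => // *; exact: Fc.
by rewrite ler_norml; lra.
Qed.

(** Both hypotheses have the center [q] as second argument, as in the ball condition, so symmetry is
    built in. *)
Lemma D_KS_triangle (p q s : probability R R) (b c : R) :
  D_KS p q <= b%:E -> D_KS s q <= c%:E -> D_KS p s <= (b + c)%:E.
Proof.
move=> /D_KS_le_fineP pq /D_KS_le_fineP sq; apply/D_KS_le_fineP => t.
by move: (pq t) (sq t); rewrite !ler_norml; lra.
Qed.

End kolmogorov.

(** * Mixtures of a kernel against a probability *)

Section mixture.
Context {d1 d2 : measure_display} {T : measurableType d1} {Z : measurableType d2}
  {R : realType} (mu : probability T R) (k : T -> probability Z R)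
  (mk : forall U, measurable U -> measurable_fun [set: T] (fun t => k t U)).

(** [mu] becomes a kernel from a one-point space and [k] a kernel on [unit * T], so that the mixture
    is a composition of kernels. *)
Let base (_ : unit) : {measure set T -> \bar R} := mu.

Let measurable_base U : measurable U -> measurable_fun [set: unit] (base ^~ U).
Proof. by move=> _; exact: measurable_cst. Qed.

HB.instance Definition _ := isKernel.Build _ _ unit T R base measurable_base.

Let base1 x : base x [set: T] = 1. Proof. exact: probability_setT. Qed.

HB.instance Definition _ := Kernel_isProbability.Build _ _ unit T R base base1.

Let fiber (x : unit * T) : {measure set Z -> \bar R} := k x.2.

Let measurable_fiber U : measurable U -> measurable_fun [set: unit * T] (fiber ^~ U).
Proof. by move=> mU; exact: measurableT_comp (mk mU) measurable_snd. Qed.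

HB.instance Definition _ :=
  isKernel.Build _ _ (unit * T)%type Z R fiber measurable_fiber.

Let fiber1 x : fiber x [set: Z] = 1. Proof. exact: probability_setT. Qed.

HB.instance Definition _ :=
  Kernel_isProbability.Build _ _ (unit * T)%type Z R fiber fiber1.

Let mixture_setT : mkcomp base fiber tt [set: Z] = 1.
Proof.
suff : \int[mu]_t k t [set: Z] = 1 by [].
rewrite (eq_integral (cst 1)) => [|t _]; last exact: probability_setT.
by rewrite integral_cst// mul1e; exact: probability_setT.
Qed.

Let mixture : probability Z R :=
  HB.pack (mkcomp base fiber tt : set Z -> \bar R)
    (Measure.class (mkcomp base fiber tt))
    (Measure_isProbability.Build _ _ _ (mkcomp base fiber tt) mixture_setT).

(** The second clause is Tonelli for a composition of kernels. *)
Lemma mixture_exists : exists m : probability Z R,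
  (forall U, m U = \int[mu]_t k t U) /\
  (forall f, (forall z, 0 <= f z) -> measurable_fun [set: Z] f ->
    \int[m]_z f z = \int[mu]_t \int[k t]_z f z).
Proof.
exists mixture; split=> // f f0 mf.
exact: (@integral_kcomp _ _ _ _ _ _ _ base fiber tt f f0 mf).
Qed.

End mixture.

(** * The coupling induced by a kernel *)

Section kernel_coupling.
Context {d : measure_display} {T : measurableType d} {R : realType}
  (mu : probability T R) (k : T -> probability R R)
  (mk : forall U, measurable U -> measurable_fun [set: T] (fun t => k t U))
  (g : T -> R) (mg : measurable_fun [set: T] g).

Let kk t : {measure set R -> \bar R} := k t.

HB.instance Definition _ := isKernel.Build _ _ T R R kk mk.

Let kk1 x : kk x [set: R] = 1. Proof. exact: probability_setT. Qed.

HB.instance Definition _ := Kernel_isProbability.Build _ _ T R R kk kk1.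

(** The set measured by [k t] is the section at [t] of a measurable subset [V] of [T * R], and a
    finite kernel measures sections measurably. *)
Lemma measurable_fun_kernel_pair U : measurable U ->
  measurable_fun [set: T] (fun t => k t [set y | U (g t, y)]).
Proof.
move=> mU.
pose V := [set z : T * R | U (g z.1, z.2)].
have mV : measurable V.
  have mf : measurable_fun setT (fun z : T * R => (g z.1, z.2)).
    apply/measurable_fun_pairP; split; last exact: measurable_snd.
    exact: measurableT_comp mg measurable_fst.
  by rewrite -[V]setTI; exact: mf.
rewrite (_ : (fun t => _) = (fun t => kk t (xsection V t))); last first.
  by apply/funext => t; rewrite xsectionE.
by apply: (@measurable_fun_xsection_finite_kernel _ _ T R R kk); rewrite inE.
Qed.

Let mpair t : measurable_fun [set: R] (fun y : R => (g t, y)).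
Proof. exact: measurable_pair1. Qed.

Let HX t := @isMeasurableFun.Build _ _ R (R * R)%type (fun y : R => (g t, y)) (mpair t).
Let X t : {mfun R >-> (R * R)%type} := HB.pack (fun y : R => (g t, y)) (HX t).
(** The product of the Dirac mass at [g t] with [k t]; mixing it over [t] gives the coupling. *)
Let kp t : probability (R * R)%type R := distribution (k t) (X t).

Let sqr_diff_ge0 (z : R * R) : 0 <= ((z.1 - z.2) ^+ 2)%:E.
Proof. by rewrite lee_fin sqr_ge0. Qed.

Let measurable_sqr_diff :
  measurable_fun [set: R * R] (fun z : R * R => ((z.1 - z.2) ^+ 2)%:E).
Proof.
apply/measurable_EFinP; apply: measurable_funX; apply: measurable_funB.
  exact: measurable_fst.
exact: measurable_snd.
Qed.

Let kernel_costE t :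
  \int[k t]_y ((y - g t) ^+ 2)%:E = \int[kp t]_z ((z.1 - z.2) ^+ 2)%:E.
Proof.
rewrite /kp /distribution ge0_integral_pushforward//=.
by apply: eq_integral => y _ /=; rewrite -sqrrN opprB.
Qed.

(** Rewritten with [kp], the integrand no longer depends on [t]; integrating a fixed nonnegative
    function against a kernel is measurable in [t]. *)
Lemma measurable_fun_kernel_cost :
  measurable_fun [set: T] (fun t => \int[k t]_y ((y - g t) ^+ 2)%:E).
Proof.
under eq_fun do rewrite kernel_costE.
apply: (@measurable_fun_integral_kernel _ _ T (R * R)%type R kp) => // U mU.
exact: measurable_fun_kernel_pair.
Qed.

(** The mixture of [kp] couples the law of [g] with the mixture [m] of [k], and its cost is the
    right-hand side. *)
Lemma W2sq_le_kernel_cost : exists m : probability R R,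
  (forall U, m U = \int[mu]_t k t U) /\
  W2sq (fun B => mu (g @^-1` B)) m <=
    \int[mu]_t \int[k t]_y ((y - g t) ^+ 2)%:E.
Proof.
have [m [mE _]] := mixture_exists mu mk; exists m; split=> //.
have [pi [piE pi_int]] := mixture_exists mu (k := kp) measurable_fun_kernel_pair.
apply: ge_ereal_inf; exists (\int[pi]_z ((z.1 - z.2) ^+ 2)%:E); last first.
  rewrite pi_int// le_eqVlt; apply/orP; left; apply/eqP.
  by apply: eq_integral => t _; rewrite kernel_costE.
exists pi => //; split => B mB.
  (* Under [kp t] the first coordinate is the constant [g t], so the mass is 1 or 0 according to
     whether [g t] lies in [B]. *)
  rewrite piE (eq_integral (fun t => (\1_(g @^-1` B) t)%:E)); last first.
    move=> t _; rewrite /kp /distribution /pushforward/= indicE.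
    have [gB|gB] := boolP (t \in g @^-1` B).
      transitivity (k t setT); last exact: probability_setT.
      congr (k t _); apply/seteqP; split=> // y _; split=> //=.
      by move: gB; rewrite inE.
    transitivity (k t set0); last exact: measure0.
    congr (k t _); apply/seteqP; split=> // y [/= By _].
    by move: gB; rewrite notin_setE.
  rewrite integral_indic ?setIT// -[X in measurable X]setTI; exact: mg.
rewrite piE mE; apply: eq_integral => t _; rewrite /kp /distribution /pushforward/=.
by congr (k t _); apply/seteqP; split=> [y []//|y By]; split.
Qed.

End kernel_coupling.

(** * Conditioning a probability on an event *)

Section conditioning.
Context {d : measure_display} {T : measurableType d} {R : realType}.

(** The restricted measure vanishes off [D] and agrees with [mu] on subsets of [D]. *)
Lemma ge0_integral_mrestr (mu : {measure set T -> \bar R}) (D : set T)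
    (mD : measurable D) (f : T -> \bar R) :
  measurable_fun [set: T] f -> (forall x, 0 <= f x) ->
  \int[mrestr mu mD]_x f x = \int[mu]_(x in D) f x.
Proof.
move=> mf f0; have mDc : measurable (~` D) by exact: measurableC.
rewrite -(setUv D) ge0_integral_setU//; last 2 first.
- exact: measurable_funTS.
- by rewrite disj_set2E setICr.
rewrite [X in _ + X]null_set_integral//; last 2 first.
- exact: measurable_funTS.
- by apply: (_ : mu _ = 0); rewrite setICl measure0.
rewrite adde0; apply: eq_measure_integral => A mA AD.
by apply: (_ : mu _ = mu _); congr (mu _); exact/setIidPl.
Qed.

Lemma conditional_exists (mu : probability T R) (D : set T) :
  measurable D -> mu D != 0 -> exists nu : probability T R,
  (forall U, nu U = (fine (mu D))^-1%:E * mu (D `&` U)) /\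
  (forall f, measurable_fun [set: T] f -> (forall x, 0 <= f x) ->
    \int[nu]_x f x = (fine (mu D))^-1%:E * \int[mu]_(x in D) f x).
Proof.
move=> mD muD0; pose m := mnormalize (mrestr mu mD) mu.
have mE U : m U = (fine (mu D))^-1%:E * mu (D `&` U).
  have DT : mrestr mu mD [set: T] = mu D by apply: (_ : mu _ = _); rewrite setTI.
  (* [mnormalize] falls back to its second argument when the total mass is zero or infinite; both
     cases are excluded. *)
  have Doo : (mu D == +oo) = false.
    by apply/negbTE; rewrite -ltey ltey_eq fin_num_measure.
  rewrite /m /= /mnormalize /= DT Doo (negbTE muD0)/= muleC setIC.
  by [].
exists m; split=> // f mf f0.
have w0 : (0 <= (fine (mu D))^-1)%R by rewrite invr_ge0 fine_ge0.
rewrite -(ge0_integral_mrestr mu mD)// -(ge0_integral_mscale _ measurableT (NngNum w0))//.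
apply: eq_measure_integral => A mA _; apply: (eq_trans (mE A)); rewrite setIC.
by [].
Qed.

End conditioning.

(** * Approximate disintegration along a countable partition *)

Section disintegration.
Context {R : realType} (pi : probability (R * R)%type R).

(** [kap] is the law of the second coordinate given [E]. Multiplying by [pi E] instead of dividing
    keeps the identity valid for null [E], where any law serves. *)
Lemma conditional_snd_exists (E : set (R * R)) : measurable E ->
  exists kap : probability R R,
    forall H : R -> \bar R, measurable_fun [set: R] H -> (forall y, 0 <= H y) ->
    (\int[kap]_y H y) * pi E = \int[pi]_(z in E) H z.2.
Proof.
move=> mE.
pose HX := @isMeasurableFun.Build _ _ (R * R)%type R (@snd R R) measurable_snd.
pose X : {mfun (R * R)%type >-> R} := HB.pack (@snd R R) HX.
have mX (H : R -> \bar R) : measurable_fun [set: R] H ->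
    measurable_fun [set: R * R] (H \o snd).
  by move=> mH; exact: measurableT_comp mH measurable_snd.
have [E0|E0] := eqVneq (pi E) 0.
  exists (distribution pi X) => H mH H0; rewrite E0 mule0 null_set_integral//.
  exact: measurable_funTS (mX _ mH).
have [nu [_ nuE]] := conditional_exists mE E0.
exists (distribution nu X) => H mH H0.
have Efin : pi E \is a fin_num by exact: fin_num_measure.
rewrite ge0_integral_pushforward// nuE//=; last exact: mX.
rewrite muleAC -[X in _ * X * _](fineK Efin) -EFinM mulVf ?mul1e//.
by rewrite fine_eq0.
Qed.

Context (c : R -> nat) (mc : forall n, measurable (c @^-1` [set n])).

Let cell n : set (R * R) := [set z | c z.1 = n].

Let measurable_cell n : measurable (cell n).
Proof.
rewrite (_ : cell n = (c @^-1` [set n]) `*` setT); first exact: measurableX.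
by apply/seteqP; split=> [z //|z []].
Qed.

(** A preimage is a countable union of cells. *)
Lemma measurable_fun_cell (F : nat -> \bar R) : measurable_fun [set: R] (F \o c).
Proof.
apply: measurableT_comp => //.
move=> _ B _; rewrite setTI (_ : _ @^-1` _ = \bigcup_(n in B) c @^-1` [set n]).
  exact: bigcup_measurable.
by apply/seteqP; split=> [y By|y [n Bn /= ->]//]; exists (c y).
Qed.

(** [F n] plays the average of [G] on cell [n]; the cellwise identities are summed over the
    countable partition. *)
Lemma integral_cell (F : nat -> \bar R) (G : R * R -> \bar R) :
  (forall n, 0 <= F n) -> (forall z, 0 <= G z) -> measurable_fun [set: R * R] G ->
  (forall n, F n * pi (cell n) = \int[pi]_(z in cell n) G z) ->
  \int[pi]_z F (c z.1) = \int[pi]_z G z.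
Proof.
move=> F0 G0 mG FG.
have cellT : \bigcup_n cell n = [set: R * R].
  by apply/seteqP; split=> // z _; exists (c z.1).
have tcell : trivIset [set: nat] cell.
  apply/trivIsetP => i j _ _ ij; apply/seteqP; split=> // z [zi zj].
  by move: ij; rewrite -(zi : c z.1 = i) -(zj : c z.1 = j) eqxx.
rewrite -cellT ge0_integral_bigcup//; last first.
  by apply: measurable_funTS; exact: measurableT_comp (measurable_fun_cell F) measurable_fst.
rewrite ge0_integral_bigcup//; last by rewrite cellT.
apply: eq_eseriesr => n _; rewrite -FG -integral_cst//.
by apply: eq_integral => z /[!inE] zn /=; congr (F _).
Qed.

(** [kap y] is the conditional law of the second coordinate given that the first lies in the cell of
    [y]. Averaging over cells restores the second marginal exactly, while the first coordinate moves
    by at most [delta] inside its cell. *)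
Lemma cell_kernel_exists {d : measure_display} {T : measurableType d}
  (mu : probability T R) (g : T -> R) (mg : measurable_fun [set: T] g)
  (pi1 : forall B, measurable B -> pi (B `*` setT) = mu (g @^-1` B))
  (delta : R) (delta0 : (0 < delta)%R)
  (cdelta : forall x y, c x = c y -> (`|x - y| <= delta)%R) :
  exists kap : R -> probability R R,
  [/\ forall U, measurable U -> measurable_fun [set: R] (fun y => kap y U),
     forall U, measurable U -> \int[mu]_t kap (g t) U = pi (setT `*` U) &
     \int[mu]_t \int[kap (g t)]_y ((y - g t) ^+ 2)%:E <=
     (1 + delta)%:E * \int[pi]_z ((z.1 - z.2) ^+ 2)%:E + (delta + delta ^+ 2)%:E].
Proof.
have [kap kapE] := choice (fun n => conditional_snd_exists (measurable_cell n)).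
(* By [pi1], [g] under [mu] and the first coordinate under [pi] have the same law. *)
have transfer (h : R -> \bar R) : measurable_fun [set: R] h -> (forall y, 0 <= h y) ->
    \int[mu]_t h (g t) = \int[pi]_z h z.1.
  move=> mh h0.
  transitivity (\int[pushforward mu g]_y h y); first by rewrite ge0_integral_pushforward.
  transitivity (\int[pushforward pi fst]_y h y); last first.
    by rewrite (ge0_integral_pushforward measurable_fst).
  apply: eq_measure_integral => B mB _; apply: (eq_trans (esym (pi1 _ mB))).
  apply: (_ : _ = pi _); congr (pi _); apply/seteqP; by split=> [z []|z Bz].
have mkap U : measurable U -> measurable_fun [set: R] (fun y => kap (c y) U).
  by move=> mU; exact: (measurable_fun_cell (fun n => kap n U)).
exists (fun y => kap (c y)); split=> [|U mU|]; first exact: mkap.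
  rewrite (transfer (fun y => kap (c y) U))//; last exact: mkap.
  have mTU : measurable ([set: R] `*` U) by exact: measurableX.
  rewrite (@integral_cell (fun n => kap n U) (fun z => (\1_([set: R] `*` U) z)%:E))//.
  - by rewrite integral_indic// setIT.
  - exact/measurable_EFinP.
  - move=> n; have := kapE n (fun y => (\1_U y)%:E).
    rewrite integral_indic// setIT => ->//; last exact/measurable_EFinP.
    apply: eq_integral => z _; congr (_ %:E); rewrite !indicE.
    by congr (nat_of_bool _)%:R; apply/idP/idP; rewrite !inE => // -[].
(* [G z] bounds the squared distance from [z.2] to any point of the cell of [z.1]. *)
pose G (z : R * R) := ((1 + delta) * (z.1 - z.2) ^+ 2 + (delta + delta ^+ 2))%:E.
have mdiff : measurable_fun [set: R * R] (fun z : R * R => (z.1 - z.2) ^+ 2)%R.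
  by apply: measurable_funX; apply: measurable_funB; [exact: measurable_fst|exact: measurable_snd].
have mG : measurable_fun [set: R * R] G.
  by apply/measurable_EFinP; apply: measurable_funD => //; exact: measurable_funM.
have delta_ge0 : (0 <= delta)%R by exact: ltW.
have d1 : (0 <= 1 + delta)%R by rewrite addr_ge0.
have d2 : (0 <= delta + delta ^+ 2)%R by rewrite addr_ge0 ?sqr_ge0.
have G0 z : 0 <= G z by rewrite lee_fin addr_ge0// mulr_ge0// sqr_ge0.
have -> : (1 + delta)%:E * \int[pi]_z ((z.1 - z.2) ^+ 2)%:E + (delta + delta ^+ 2)%:E
    = \int[pi]_z G z.
  rewrite /G; under [RHS]eq_integral do rewrite EFinD EFinM.
  rewrite ge0_integralD//; last 2 first.
  - by move=> z _; rewrite mule_ge0// lee_fin sqr_ge0.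
  - by apply: measurable_funeM; exact/measurable_EFinP.
  rewrite ge0_integralZl_EFin//.
    + have pi1' : measure_function.Measure.sort pi setT = 1 by exact: probability_setT.
      by rewrite integral_cst// pi1' mule1.
    + by move=> z _; rewrite lee_fin sqr_ge0.
    + exact/measurable_EFinP.
(* Cell averages of [G]. The value [+oo] on null cells makes the final comparison hold at every
   point, and costs nothing since [+oo * 0 = 0]. *)
pose F n := if pi (cell n) == 0 then +oo
            else (fine (pi (cell n)))^-1%:E * \int[pi]_(z in cell n) G z.
have F0 n : 0 <= F n.
  rewrite /F; case: ifP => // _; rewrite mule_ge0//; last exact: integral_ge0.
  by rewrite lee_fin invr_ge0 fine_ge0.
have Efin n : pi (cell n) \is a fin_num by exact: fin_num_measure.
have FG n : F n * pi (cell n) = \int[pi]_(z in cell n) G z.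
  rewrite /F; have [E0|E0] := eqVneq (pi (cell n)) 0.
    by rewrite [X in _ * X]E0 mule0 null_set_integral//; exact: measurable_funTS.
  by rewrite muleAC -[X in _ * X * _](fineK (Efin n)) -EFinM mulVf ?mul1e// fine_eq0.
(* The bound becomes an integral over [mu], so that the two sides can be compared pointwise in
   [t]. *)
rewrite -(integral_cell F0 G0 mG FG) -(transfer (F \o c)); last 2 first.
- exact: measurable_fun_cell.
- by move=> y; exact: F0.
apply: ge0_le_integral => //.
- by move=> t _; apply: integral_ge0 => y _; rewrite lee_fin sqr_ge0.
- apply: (measurable_fun_kernel_cost (k := fun t => kap (c (g t)))) => // U mU.
  exact: measurableT_comp (mkap _ mU) mg.
- exact: measurableT_comp (measurable_fun_cell F) mg.
move=> t _ /=; set y' := g t; set n := c y'.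
rewrite /F; have [_|E0] := eqVneq (pi (cell n)) 0; first exact: leey.
set I := (X in X <= _).
(* Multiplying and dividing by the nonzero cell mass brings [I] into the form handled by [kapE]. *)
have -> : I = (fine (pi (cell n)))^-1%:E * (I * pi (cell n)).
  by rewrite muleCA -[X in _ * (_ * X)](fineK (Efin n)) -EFinM mulVf ?mule1// fine_eq0.
rewrite lee_wpmul2l//; first by rewrite lee_fin invr_ge0 fine_ge0.
rewrite /I (kapE n (fun y => ((y - y') ^+ 2)%:E)); last 2 first.
- by apply/measurable_EFinP; apply: measurable_funX; exact: measurable_funB.
- by move=> y; rewrite lee_fin sqr_ge0.
apply: ge0_le_integral => //.
- by move=> z _; rewrite lee_fin sqr_ge0.
- apply/measurable_EFinP; apply: measurable_funTS; apply: measurable_funX.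
  by apply: measurable_funB => //; exact: measurable_snd.
- exact: measurable_funTS.
move=> z zn; rewrite lee_fin.
have /cdelta : c z.1 = c y' by exact: zn.
rewrite ler_norml => /andP[? ?].
pose u := (z.2 - z.1)%R; pose v := (z.1 - y')%R.
(* (u + v)^2 <= (1 + delta) u^2 + delta + delta^2 since 2uv <= delta (u^2 + 1) *)
have ? : (v ^+ 2 <= delta ^+ 2)%R by rewrite /v; nra.
have ? : (2 * u * v <= delta * (u ^+ 2 + 1))%R.
  have ? : (-1 - u ^+ 2 <= 2 * u)%R by have := sqr_ge0 (u + 1); lra.
  have ? : (2 * u <= 1 + u ^+ 2)%R by have := sqr_ge0 (u - 1); lra.
  by rewrite /v; nra.
have -> : (z.2 - y' = u + v)%R by rewrite /u /v; ring.
have -> : ((z.1 - z.2) ^+ 2 = u ^+ 2)%R by rewrite /u; ring.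
by lra.
Qed.

End disintegration.

(** * Kernels of nearly optimal transport cost *)

Section near_optimal_kernel.
Context {R : realType}.

(** The cells are the half-open intervals between consecutive multiples of [delta]; [pickle] codes
    their integer index as a natural number. *)
Lemma bounded_cells_exist (delta : R) : (0 < delta)%R -> exists c : R -> nat,
  (forall n, measurable (c @^-1` [set n])) /\
  (forall x y, c x = c y -> (`|x - y| <= delta)%R).
Proof.
move=> d0; pose fl (y : R) := Num.floor (y / delta).
have flP y : ((fl y)%:~R * delta <= y < ((fl y)%:~R + 1) * delta)%R.
  have := floor_itv (y / delta); rewrite -/(fl y) intrD1 => /andP[a b].
  by rewrite -ler_pdivlMr// a -ltr_pdivrMr.
exists (fun y => pickle (fl y)); split=> [n|x y]; last first.
  move=> /(pcan_inj pickleK) xy; have := flP x; have := flP y; rewrite xy.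
  by move=> /andP[? ?] /andP[? ?]; rewrite ler_norml; lra.
(* A natural number that codes no integer index has an empty cell. *)
have [[y0 y0n]|no] := pselect (exists y0, pickle (fl y0) = n); last first.
  rewrite (_ : _ @^-1` _ = set0) ?measurable0//.
  by apply/seteqP; split=> // y yn; case: no; exists y.
rewrite (_ : _ @^-1` _ = `[((fl y0)%:~R * delta)%R, (((fl y0)%:~R + 1) * delta)%R[%classic).
  exact: measurable_itv.
apply/seteqP; split=> y /=.
  by rewrite -y0n in_itv/= => /(pcan_inj pickleK) <-; exact: flP.
rewrite in_itv/= -y0n => /andP[a b]; congr pickle; apply/eqP; rewrite floor_eq.
by rewrite intrD1 ler_pdivlMr// a ltr_pdivrMr.
Qed.

Lemma W2sq_ge0 (p q : set R -> \bar R) : 0 <= W2sq p q.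
Proof.
apply: le_ereal_inf_tmp => _ [pi _ <-]; apply: integral_ge0 => z _.
by rewrite lee_fin sqr_ge0.
Qed.

(** Half of [e] pays for a nearly optimal coupling, the other half for the partition into cells. *)
Lemma near_optimal_kernel_exists {d : measure_display} {T : measurableType d}
    (mu : probability T R) (g : T -> R) (q : probability R R) (e : R) :
  measurable_fun [set: T] g -> (0 < e)%R -> W2sq (fun B => mu (g @^-1` B)) q < +oo ->
  exists kap : R -> probability R R,
  [/\ forall U, measurable U -> measurable_fun [set: R] (fun y => kap y U),
     forall U, measurable U -> \int[mu]_t kap (g t) U = q U &
     \int[mu]_t \int[kap (g t)]_y ((y - g t) ^+ 2)%:E <=
     W2sq (fun B => mu (g @^-1` B)) q + e%:E].
Proof.
move=> mg e0; set W := W2sq _ _ => Woo.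
have Wfin : W \is a fin_num by rewrite ge0_fin_numE// W2sq_ge0.
have W0 : (0 <= fine W)%R by rewrite fine_ge0// W2sq_ge0.
have e2 : (0 < e / 2)%R by rewrite divr_gt0.
have [_ [pi [pi1 pi2] <-] piW] := lb_ereal_inf_adherent e2 Wfin.
(* With [C] the cost of [pi], the cells add [delta * (C + 1 + delta)]. As [C < W + e / 2] and
   [delta <= 1], the second factor is below [D / 2], and [delta * D = e]. *)
pose D := (2 * fine W + 2 * e + 4)%R.
have D0 : (0 < D)%R by rewrite /D; lra.
pose delta := (e / D)%R.
have delta0 : (0 < delta)%R by rewrite divr_gt0.
have [c [mc cdelta]] := bounded_cells_exist delta0.
have [kap [k1 k2 k3]] := cell_kernel_exists mc mg pi1 delta0 cdelta.
exists kap; split=> // [U mU|]; first by rewrite k2// pi2.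
apply: le_trans k3 _.
have c0 : 0 <= \int[pi]_z ((z.1 - z.2) ^+ 2)%:E.
  by apply: integral_ge0 => z _; rewrite lee_fin sqr_ge0.
move: piW c0; rewrite -/(W2sq _ _) -/W; case: (\int[pi]_z _) => [C| |]; rewrite -(fineK Wfin)//.
rewrite -EFinM -!EFinD lte_fin !lee_fin => CW C0.
have deltaD : (delta * D = e)%R by rewrite /delta divfK// gt_eqF.
have delta1 : (delta <= 1)%R by rewrite ler_pdivrMr// mul1r /D; lra.
have : (delta * (C + 1 + delta) <= delta * (D / 2))%R.
  by rewrite ler_pM2l// /D; lra.
by nra.
Qed.

End near_optimal_kernel.

(** * Groupwise form of the output laws and of the risk *)

Section fair_regression.
Context {R : realType} {dO : measure_display} {Omega : measurableType dO}
  (P : probability Omega R) {dX : measure_display} {Xsp : measurableType dX}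
  {A : finType} (X : Omega -> Xsp) (Aa : Omega -> A) (fstar : Xsp -> A -> R)
  (mX : measurable_fun [set: Omega] X)
  (mA : forall a : A, measurable (Aa @^-1` [set a]))
  (wpos : forall a : A, (0 < wA P Aa a)%R)
  (mfstar : forall a : A, measurable_fun [set: Xsp] (fun x => fstar x a)).

(** [nu a] is [P] conditioned on group [a], which has positive mass by [wpos]. *)
Lemma group_conditional_exists : exists nu : A -> probability Omega R, forall a,
  (forall U, nu a U = (wA P Aa a)^-1%:E * P (Aa @^-1` [set a] `&` U)) /\
  (forall f, measurable_fun [set: Omega] f -> (forall w, 0 <= f w) ->
    \int[nu a]_w f w = (wA P Aa a)^-1%:E * \int[P]_(w in Aa @^-1` [set a]) f w).
Proof.
have H a := conditional_exists (mu := P) (mA a).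
have Pa a : P (Aa @^-1` [set a]) != 0.
  by apply: contraTneq (wpos a) => Pa0; rewrite /wA Pa0 ltxx.
have [nu nuP] := choice (fun a => H a (Pa a)).
by exists nu.
Qed.

Context (nu : A -> probability Omega R)
  (nuE : forall a U, nu a U = (wA P Aa a)^-1%:E * P (Aa @^-1` [set a] `&` U))
  (nu_int : forall a f, measurable_fun [set: Omega] f -> (forall w, 0 <= f w) ->
    \int[nu a]_w f w = (wA P Aa a)^-1%:E * \int[P]_(w in Aa @^-1` [set a]) f w).

Lemma r_detE a : r_det P X Aa fstar a = fun B => nu a ((fun w => fstar (X w) a) @^-1` B).
Proof. by apply/funext => B; rewrite nuE. Qed.

Lemma markov_kernel_comp (K : A -> Xsp -> probability R R) :
  markov_kernel K -> forall a U, measurable U ->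
  measurable_fun [set: Omega] (fun w => K a (X w) U).
Proof. by move=> mK a U mU; exact: measurableT_comp (mK a U mU) mX. Qed.

Lemma r_ofE (K : A -> Xsp -> probability R R) a U : markov_kernel K -> measurable U ->
  r_of P X Aa K a U = \int[nu a]_w K a (X w) U.
Proof. by move=> mK mU; rewrite nu_int//; exact: markov_kernel_comp. Qed.

(** Law of total expectation over the groups; each weight cancels the normalization of [nu a]. *)
Lemma ERE (K : A -> Xsp -> probability R R) : markov_kernel K -> ER P X Aa fstar K =
  \sum_(a : A) (wA P Aa a)%:E *
    \int[nu a]_w \int[K a (X w)]_y ((y - fstar (X w) a) ^+ 2)%:E.
Proof.
move=> mK; pose h a w := \int[K a (X w)]_y ((y - fstar (X w) a) ^+ 2)%:E.
have h0 a w : 0 <= h a w by apply: integral_ge0 => y _; rewrite lee_fin sqr_ge0.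
have mh a : measurable_fun [set: Omega] (h a).
  apply: (measurable_fun_kernel_cost (k := fun w => K a (X w))) => [U mU|].
    exact: markov_kernel_comp.
  exact: measurableT_comp (mfstar a) mX.
pose D a := Aa @^-1` [set a].
(* At each [w] only the term of the group [Aa w] survives. *)
transitivity (\int[P]_w (\sum_(a <- index_enum A) (h a \_ (D a)) w)).
  apply: eq_integral => w _.
  rewrite (bigD1_seq (Aa w)) ?index_enum_uniq ?mem_index_enum//= big1 ?adde0.
    by rewrite patchE mem_set.
  move=> a aw; rewrite patchE memNset//= => waE.
  by rewrite /D/= in waE; rewrite waE eqxx in aw.
rewrite ge0_integral_sum//; last 2 first.
- by move=> a; apply/(measurable_restrictT _ (mA a)); exact: measurable_funTS.
- by move=> a w _; exact: erestrict_ge0.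
apply: eq_bigr => a _; rewrite -integral_mkcond (@nu_int _ (h a) (mh a) (h0 a)).
by rewrite muleA -EFinM divff ?mul1e// gt_eqF.
Qed.

End fair_regression.

(** * Comparison of the two infima *)

Theorem theorem1 (R : realType)
  (dO : measure_display) (Omega : measurableType dO) (P : probability Omega R)
  (dX : measure_display) (Xsp : measurableType dX) (A : finType)
  (X : Omega -> Xsp) (Aa : Omega -> A) (Y : Omega -> R)
  (fstar : Xsp -> A -> R)
  (mX : measurable_fun [set: Omega] X)
  (mA : forall a : A, measurable (Aa @^-1` [set a]))
  (mY : measurable_fun [set: Omega] Y)
  (wpos : forall a : A, (0 < wA P Aa a)%R)
  (Y2 : P.-integrable [set: Omega] (fun w => ((Y w) ^+ 2)%:E))
  (mfstar : forall a : A, measurable_fun [set: Xsp] (fun x => fstar x a))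
  (ifstar : P.-integrable [set: Omega] (fun w => (fstar (X w) (Aa w))%:E))
  (hfstar : forall (B : set Xsp) (a : A), measurable B ->
     \int[P]_(w in X @^-1` B `&` Aa @^-1` [set a]) (Y w)%:E =
     \int[P]_(w in X @^-1` B `&` Aa @^-1` [set a]) (fstar (X w) (Aa w))%:E)
  (alpha : R) (halpha : (0 <= alpha)%R) :
  ereal_inf [set ER P X Aa fstar K | K in
     [set K : A -> Xsp -> probability R R |
        markov_kernel K /\ DeltaSP (r_of P X Aa K) <= alpha%:E]]
  =
  ereal_inf [set \sum_(a : A) (wA P Aa a)%:E * W2sq (r_det P X Aa fstar a) (qa a)
            | qa in [set qa : A -> probability R R |
                exists q : probability R R,
                  forall a : A, D_KS (qa a) q <= (alpha / 2)%:E]].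
Proof.
have [nu nuP] := group_conditional_exists mA wpos.
have nuE a U := (nuP a).1 U.
have nu_int a f mf f0 := (nuP a).2 f mf f0.
(* A probability space has a point, hence some group exists; it seeds the center and makes the total
   weight positive. *)
have [w0 _] : [set: Omega] !=set0.
  apply/set0P/eqP => O0; have := probability_setT P; rewrite O0 measure0.
  by move=> /eqP; rewrite eq_sym onee_eq0.
pose a0 := Aa w0.
have mg a : measurable_fun [set: Omega] (fun w => fstar (X w) a).
  exact: measurableT_comp (mfstar a) mX.
have rdE a := r_detE X fstar nuE a.
apply/eqP; rewrite eq_le; apply/andP; split.
(* From laws near a common center to a fair regressor. If some transport cost is infinite, its
   positive weight makes the whole sum [+oo]. *)
- apply: le_ereal_inf_tmp => _ [qa [q qaq] <-].
  have [allfin|] := pselect (forall a, W2sq (r_det P X Aa fstar a) (qa a) < +oo); last first.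
    move=> /existsNP[a /negP]; rewrite -leNgt leye_eq => /eqP Wa.
    rewrite (_ : \sum_(a : A) _ = +oo) ?leey//; apply/esum_eqyP.
      move=> b _; rewrite gt_eqF// (lt_le_trans (ltNyr 0%R))// mule_ge0 ?W2sq_ge0//.
      by rewrite lee_fin ltW.
    by exists a; split; rewrite ?mem_index_enum//= Wa gt0_muley// lte_fin.
  apply/lee_addgt0Pr => e e0.
  (* A slack of [e / s] in each group, weighted and summed, is exactly [e]. *)
  pose s := (\sum_(a : A) wA P Aa a)%R.
  have s0 : (0 < s)%R.
    rewrite /s (bigD1 a0)//= ltr_pwDl// sumr_ge0// => a _; exact: ltW.
  have es : (0 < e / s)%R by rewrite divr_gt0.
  have kapE a : exists kap : R -> probability R R,
      [/\ forall U, measurable U -> measurable_fun [set: R] (fun y => kap y U),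
       forall U, measurable U -> \int[nu a]_t kap (fstar (X t) a) U = qa a U &
       \int[nu a]_t \int[kap (fstar (X t) a)]_y ((y - fstar (X t) a) ^+ 2)%:E <=
       W2sq (r_det P X Aa fstar a) (qa a) + (e / s)%:E].
    have := allfin a; rewrite rdE => Wa.
    exact: near_optimal_kernel_exists (mg a) es Wa.
  have [kap kapP] := choice kapE.
  pose K a x := kap a (fstar x a).
  have mK : markov_kernel K.
    move=> a U mU; have [mk _ _] := kapP a.
    exact: measurableT_comp (mk _ mU) (mfstar a).
  (* [D_KS] sees only half-lines, so agreement there transfers the parity constraint. *)
  have rK a t : r_of P X Aa K a `]-oo, t]%classic = qa a `]-oo, t]%classic.
    by have [_ kU _] := kapP a; rewrite (r_ofE mX nu_int)// kU.
  apply: ge_ereal_inf; exists (ER P X Aa fstar K).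
    exists K => //; split=> //; apply/DeltaSP_leP => a a'; apply/D_KS_leP => t.
    rewrite !rK; move: t; apply/D_KS_leP.
    by rewrite (splitr alpha); exact: D_KS_triangle (qaq a) (qaq a').
  rewrite (ERE mX mA wpos mfstar nu_int mK).
  apply: (@le_trans _ _ (\sum_(a : A) (wA P Aa a)%:E *
      (W2sq (r_det P X Aa fstar a) (qa a) + (e / s)%:E))).
    apply: lee_sum => a _; rewrite lee_wpmul2l//; first by rewrite lee_fin ltW.
    by have [_ _] := kapP a.
  rewrite le_eqVlt; apply/orP; left; apply/eqP.
  transitivity (\sum_(a : A) ((wA P Aa a)%:E * W2sq (r_det P X Aa fstar a) (qa a) +
      (wA P Aa a * (e / s))%:E)).
    by apply: eq_bigr => a _; rewrite ge0_muleDr ?W2sq_ge0// lee_fin ltW.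
  rewrite big_split/=; congr (_ + _); rewrite sumEFin -mulr_suml -/s.
  by rewrite mulrCA divff ?mulr1// gt_eqF.
(* From a fair regressor to laws near a common center. [r_of] is a bare set function, so the mixture
   [m a] supplies the output law of group [a] as a genuine probability. *)
- apply: le_ereal_inf_tmp => _ [K [mK KD] <-].
  have mKX a U (mU : measurable U) := markov_kernel_comp mX mK a mU.
  have mP a := W2sq_le_kernel_cost (nu a) (mKX a) (mg a).
  have {mP}[m mP] := choice mP.
  have mE a t : m a `]-oo, t]%classic = r_of P X Aa K a `]-oo, t]%classic.
    by rewrite (r_ofE mX nu_int)// (mP a).1.
  have mD a a' : D_KS (m a) (m a') <= alpha%:E.
    apply/D_KS_leP => t; rewrite !mE; move: t; apply/D_KS_leP.
    by move: a a'; exact/DeltaSP_leP.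
  have [q mq] := D_KS_center a0 mD.
  apply: ge_ereal_inf; exists (\sum_(a : A) (wA P Aa a)%:E *
    W2sq (r_det P X Aa fstar a) (m a)).
    by exists m => //; exists q.
  rewrite (ERE mX mA wpos mfstar nu_int mK); apply: lee_sum => a _.
  rewrite lee_wpmul2l//; first by rewrite lee_fin ltW.
  by rewrite rdE; exact: (mP a).2.
Qed.
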